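(* Let $n$ be a positive integer and let $T\in B(\mathcal{H})$ be an operator on a Hilbert space $\mathcal{H}$. If $T$ is sub-$n$-normal, then $T$ is $n$-subnormal.
   Context: Hilbert spaces are separable and complex, and operators are bounded and linear. An operator $S$ is $n$-normal if $S^*S^n=S^nS^*$; equivalently, $S^n$ is normal. An operator $T\in B(\mathcal{H})$ is sub-$n$-normal if there exist a Hilbert space $\mathcal{K}$ containing $\mathcal{H}$ and an $n$-normal operator $S\in B(\mathcal{K})$ such that $S\mathcal{H}\subseteq\mathcal{H}$ and $T=S|_{\mathcal{H}}$. An operator is subnormal if it is the restriction of a normal operator (on a possibly larger Hilbert space) to an invariant subspace. An operator $T$ is $n$-subnormal if $T^n$ is subnormal. *)

(* Defs.v *)
From HB Require Import structures.
From mathcomp Require Import all_boot all_order all_algebra complex sesquilinear.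
From mathcomp Require Import all_classical all_reals all_analysis.
From mathcomp Require Import ring lra.

Set Implicit Arguments.
Unset Strict Implicit.
Unset Printing Implicit Defensive.

Import Order.TTheory GRing.Theory Num.Theory Num.Def numFieldNormedType.Exports.

Local Open Scope complex_scope.
Local Open Scope classical_set_scope.
Local Open Scope ring_scope.

(* The inner product is linear in its first argument. *)
HB.mixin Record isHilbert (R : realType) V of CompleteNormedModule R[i] V := {
  inner : {dot V for (@conjC R[i])};
  innerE : forall x : V, inner x x = `|x| ^+ 2;
  hilbert_separable : exists A : set V, countable A /\ dense A
}.

#[short(type="hilbertType")]
HB.structure Definition Hilbert (R : realType) :=
  {V of isHilbert R V & CompleteNormedModule R[i] V}.

Notation "''[' u , v ]" := (inner u v)
  (format "''[' u ,  v ]") : ring_scope.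

(* Norms take their values in R[i], whose order only compares complex numbers
   with the same imaginary part. *)
Definition bounded_operator (R : realType) (H K : hilbertType R)
    (T : {linear H -> K}) : Prop :=
  exists M : R[i], forall x, `|T x| <= M * `|x|.

(* By the Riesz representation theorem (riesz and adjointP below), this is the
   usual adjoint whenever S is linear and bounded. *)
Definition adjoint (R : realType) (H : hilbertType R) (S : H -> H)
    (y : H) : H :=
  xget 0 [set z | forall x, '[S x, y] = '[x, z]].

Section Adjoint.
Variables (R : realType) (H : hilbertType R).
Implicit Types (x y z p v : H).
Local Notation C := R[i].

Let N x : R := complex.Re `|x|.

Let NE x : `|x| = (N x)%:C.
Proof. by rewrite RRe_real// normr_real. Qed.

Let innerN x : '[x, x] = (N x ^+ 2)%:C.
Proof. by rewrite innerE NE [RHS]rmorphXn. Qed.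

Let N_ge0 x : 0 <= N x.
Proof. rewrite -lecR -NE; exact: normr_ge0. Qed.

Let ler_ND x y : N (x + y) <= N x + N y.
Proof. by rewrite -lecR rmorphD /= -!NE ler_normD. Qed.

Let parallelogram x y :
  N (x - y) ^+ 2 = 2 * N x ^+ 2 + 2 * N y ^+ 2 - 4 * N (2^-1 *: (x + y)) ^+ 2.
Proof.
apply: complexI.
have -> : N (2^-1 *: (x + y)) = 2^-1 * N (x + y).
  apply: complexI; rewrite rmorphM /= -!NE normrZ; congr (_ * _).
  by rewrite normfV normr_nat fmorphV /= rmorph_nat.
have -> : 4 * (2^-1 * N (x + y)) ^+ 2 = N (x + y) ^+ 2.
  by field.
have NN z : (N z)%:C * (N z)%:C = '[z, z] by rewrite innerN -rmorphM.
rewrite rmorphB !rmorphD !rmorphM /= !NN.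
have -> : (2 : R)%:C = 2%:R :> C by rewrite rmorph_nat.
have -> : '[x - y, x - y] = '[x, x] - '[x, y] - ('[y, x] - '[y, y]).
  by rewrite linearBl !linearBr.
have -> : '[x + y, x + y] = '[x, x] + '[x, y] + ('[y, x] + '[y, y]).
  by rewrite linearDl !linearDr.
ring.
Qed.

Lemma inner_conj x y : '[x, y] = conjC '[y, x].
Proof. by rewrite hermC /= expr0 mul1r. Qed.

Lemma inner_proj p v : v != 0 ->
  let t := '[p, v] / '[v, v] in
  '[p - t *: v, p - t *: v] = '[p, p] - `|'[p, v]| ^+ 2 / '[v, v].
Proof.
move=> v0 t.
have vv0 : '[v, v] != 0 by rewrite innerE expf_eq0 /= normr_eq0.
have ct : conjC t = '[v, p] / '[v, v].
  by rewrite rmorphM fmorphV /= -!inner_conj.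
have -> : '[p - t *: v, p - t *: v] =
    '[p, p] - conjC t * '[p, v] - (t * '[v, p] - t * (conjC t * '[v, v])).
  by rewrite linearBl !linearBr /= !linearZl_LR /= !linearZr_LR.
rewrite normCK -(inner_conj v p) ct /t; field.
exact: vv0.
Qed.

Lemma cauchy_schwarz x y : `|'[x, y]| <= `|x| * `|y|.
Proof.
have [->|y0] := eqVneq y 0; first by rewrite linear0r !normr0 mulr0.
rewrite -(@ler_pXn2r _ 2)// ?nnegrE ?mulr_ge0 // exprMn -!innerE.
rewrite -ler_pdivrMr; last by rewrite innerE exprn_gt0// normr_gt0.
by rewrite -subr_ge0 -inner_proj// innerE exprn_ge0.
Qed.

Lemma riesz (f : H -> C) :
  (forall a x y, f (a *: x + y) = a * f x + f y) ->
  (exists M : C, forall x, `|f x| <= M * `|x|) ->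
  exists z, forall x, f x = '[x, z].
Proof.
move=> lf [M bf].
have f0 : f 0 = 0.
  by have := lf (-1) 0 0; rewrite scaler0 addr0 mulN1r addNr.
have fZ a x : f (a *: x) = a * f x by rewrite -[a *: x]addr0 lf f0 addr0.
have fD x y : f (x + y) = f x + f y by rewrite -[x]scale1r lf mul1r scale1r.
have fN x : f (- x) = - f x by rewrite -scaleN1r fZ mulN1r.
have [fz|] := pselect (forall x, f x = 0).
  by exists 0 => x; rewrite fz linear0r.
move=> /existsNP[x0 /eqP fx0].
pose D := [set N x ^+ 2 | x in [set x | f x = 1]].
pose d := inf D.
have D0 : D !=set0.
  exists (N ((f x0)^-1 *: x0) ^+ 2); exists ((f x0)^-1 *: x0) => //=.
  by rewrite fZ mulVf.
have lD : has_lbound D by exists 0 => _ [x _ <-]; rewrite sqr_ge0.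
have d_le x : f x = 1 -> d <= N x ^+ 2.
  by move=> fx; apply: ge_inf => //; exists x.
have d_adh (e : R) : 0 < e -> exists x, f x = 1 /\ N x ^+ 2 < d + e.
  move=> e0; have [] := @inf_adherent _ D _ e0; first by split.
  by move=> _ [x fx <-] xe; exists x.
pose B (e : R) := [set x | f x = 1 /\ N x ^+ 2 < d + e].
pose F := filter_from [set e : R | 0 < e] B.
have FF : ProperFilter F.
  apply: filter_from_proper => [|e e0]; last exact: d_adh.
  apply: filter_from_filter; first by exists 1 => /=.
  move=> i j /= i0 j0; exists (Num.min i j); first by rewrite /= lt_min i0.
  move=> x [fx xd]; split; split => //; apply: lt_le_trans xd _.
    by rewrite lerD2l ge_min lexx.
  by rewrite lerD2l ge_min lexx orbT.
have Fc : cauchy F.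
  apply/cauchy_ballP => e e0.
  have [r r0 re] : exists2 r : R, 0 < r & e = r%:C.
    exists (complex.Re e); last by rewrite RRe_real// gtr0_real.
    by rewrite -ltcR RRe_real// gtr0_real.
  exists (B (r ^+ 2 / 8), B (r ^+ 2 / 8)).
    by split; exists (r ^+ 2 / 8) => //=; rewrite divr_gt0// exprn_gt0.
  move=> [x y] [/= [fx xd] [fy yd]].
  rewrite -ball_normE /= NE re ltcR.
  have := d_le (2^-1 *: (x + y)).
  rewrite fZ fD fx fy mulVf ?pnatr_eq0 // => /(_ erefl) dm.
  by have := parallelogram x y; move: (N_ge0 (x - y)); nra.
have /cvg_ex [p Fp] := @cauchy_cvg H F FF Fc.
have near_p (e r : R) : 0 < e -> 0 < r ->
    exists x, [/\ f x = 1, N x ^+ 2 < d + e & N (p - x) < r].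
  move=> e0 r0.
  have Bp : F (ball p r%:C) by apply: Fp; apply: nbhsx_ballx; rewrite ltcR.
  have Be : F (B e) by exists e.
  have [x [[fx xd]]] := filter_ex (filterI Be Bp).
  rewrite -ball_normE /= NE ltcR => xp.
  by exists x.
have fp : f p = 1.
  apply/eqP; rewrite -subr_eq0 -normr_eq0.
  have [m m0 fm] : exists2 m : R, 0 <= m & forall x, `|f x| <= m%:C * (N x)%:C.
    exists (complex.Re `|M|).
      by rewrite -lecR RRe_real ?normr_real//; exact: normr_ge0.
    move=> x; rewrite RRe_real ?normr_real// -NE.
    apply: le_trans (bf x) _.
    have : 0 <= M * `|x| by apply: le_trans (bf x).
    by move/ger0_norm => <-; rewrite normrM normr_id.
  set c := f p - 1.
  pose k : R := complex.Re `|c|.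
  have kE : `|c| = k%:C by rewrite RRe_real ?normr_real.
  have k0 : 0 <= k by rewrite -lecR -kE; exact: normr_ge0.
  rewrite kE; apply/negPn/negP => kn0.
  have kp : 0 < k.
    by rewrite lt_def k0 andbT; apply: contra kn0 => /eqP ->.
  have [|x [fx _ px]] := @near_p 1 (k / (m + 1)) ltr01.
    by rewrite divr_gt0// ltr_wpDl.
  have := fm (p - x).
  rewrite fD fN fx kE -rmorphM /= lecR.
  have m1 : 0 < m + 1 by rewrite ltr_wpDl.
  rewrite ltr_pdivlMr// in px.
  by have := N_ge0 (p - x); nra.
have dp : N p ^+ 2 <= d.
  apply/ler_addgt0Pl => e e0.
  have d0 : 0 <= d by apply: lb_le_inf => // _ [x _ <-]; rewrite sqr_ge0.
  pose e1 := Num.min 1 (e / 2).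
  have e10 : 0 < e1 by rewrite lt_min ltr01/= divr_gt0.
  have e11 : e1 <= 1 by rewrite ge_min lexx.
  have e1e : e1 <= e / 2 by rewrite ge_min lexx orbT.
  pose r := Num.min 1 (e / 2 / (2 * d + 5)).
  have r0 : 0 < r by rewrite lt_min ltr01/= !divr_gt0//; lra.
  have r1 : r <= 1 by rewrite ge_min lexx.
  have re : r * (2 * d + 5) <= e / 2.
    by rewrite -ler_pdivlMr; [rewrite ge_min lexx orbT|lra].
  have [x [_ xd px]] := near_p _ _ e10 r0.
  have := ler_ND x (p - x); rewrite addrC subrK.
  move: (N_ge0 x) (N_ge0 p) (N_ge0 (p - x)) => x0' p0 px0 pD.
  have xb : N x <= d + 2 by nra.
  have : N p <= N x + r by lra.
  nra.
have p_neq0 : '[p, p] != 0.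
  rewrite innerE expf_eq0 /= normr_eq0; apply/eqP => p0.
  by move: fp; rewrite p0 f0 => /eqP; rewrite eq_sym oner_eq0.
have orth v : f v = 0 -> '[v, p] = 0.
  move=> fv; have [->|v0] := eqVneq v 0; first by rewrite linear0l.
  have vv0 : 0 < '[v, v] by rewrite innerE exprn_gt0// normr_gt0.
  have : '[p, p] <= '[p, p] - `|'[p, v]| ^+ 2 / '[v, v].
    rewrite -inner_proj// !innerN lecR; apply: le_trans dp _; apply: d_le.
    by rewrite fD fN fZ fv mulr0 subr0.
  rewrite -subr_ge0 addrAC subrr add0r oppr_ge0 pmulr_lle0 ?invr_gt0// => le0.
  apply/eqP; rewrite inner_conj conjC_eq0 -normr_eq0 -sqrf_eq0.
  by rewrite eq_le le0 exprn_ge0.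
exists (('[p, p])^-1 *: p) => x.
have : '[x - f x *: p, p] = 0.
  by apply: orth; rewrite fD fN fZ fp mulr1 subrr.
rewrite linearBl /= linearZl_LR /= => /eqP; rewrite subr_eq0 => /eqP xp.
by rewrite linearZr_LR /= xp fmorphV /= -inner_conj mulrC mulfK.
Qed.

Lemma adjointP (S : {linear H -> H}) :
  bounded_operator S -> forall x y, '[S x, y] = '[x, adjoint S y].
Proof.
move=> [M bS] x y; rewrite /adjoint; case: xgetP => [z _ /(_ x) //|].
have [||z fz] := @riesz (fun x => '[S x, y]).
- by move=> a u v; rewrite linearP linearDl /= linearZl_LR.
- exists (M * `|y|) => u.
  apply: le_trans (cauchy_schwarz _ _) _.
  by rewrite mulrAC ler_wpM2r.
- by move=> /(_ z); case.
Qed.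

Lemma adjoint_unique (S A : H -> H) :
  (forall x y, '[S x, y] = '[x, A y]) -> adjoint S = A.
Proof.
move=> SA; apply/funext => y; rewrite /adjoint.
case: xgetP => [z _ Sz|/(_ (A y))]; last by case; move=> x; exact: SA.
have Az : '[A y - z, A y - z] = 0.
  by rewrite linearBr /= -SA Sz subrr.
by apply/esym/eqP; rewrite -subr_eq0 -normr_eq0 -sqrf_eq0 -innerE Az.
Qed.

End Adjoint.

Definition normal_operator (R : realType) (H : hilbertType R)
    (S : {linear H -> H}) : Prop :=
  adjoint S \o S = S \o adjoint S.

Definition n_normal (R : realType) (H : hilbertType R) (n : nat)
    (S : {linear H -> H}) : Prop :=
  adjoint S \o iter n S = iter n S \o adjoint S.

(* An inclusion of Hilbert spaces is represented by a linear map preserving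
   the inner product. *)
Definition hilbert_embedding (R : realType) (H K : hilbertType R)
    (J : {linear H -> K}) : Prop :=
  forall x y, '[J x, J y] = '[x, y].

(* The equation says both that the image of H is invariant under S and that T
   is the restriction of S to it. *)
Definition restricts_to (R : realType) (H K : hilbertType R)
    (J : {linear H -> K}) (S : K -> K) (T : H -> H) : Prop :=
  forall x, S (J x) = J (T x).

Definition sub_n_normal (R : realType) (H : hilbertType R) (n : nat)
    (T : H -> H) : Prop :=
  exists (K : hilbertType R) (J : {linear H -> K}) (S : {linear K -> K}),
    [/\ hilbert_embedding J, bounded_operator S, n_normal n S
      & restricts_to J S T].

Definition subnormal (R : realType) (H : hilbertType R) (T : H -> H) : Prop :=
  exists (K : hilbertType R) (J : {linear H -> K}) (S : {linear K -> K}),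
    [/\ hilbert_embedding J, bounded_operator S, normal_operator S
      & restricts_to J S T].

Definition n_subnormal (R : realType) (H : hilbertType R) (n : nat)
    (T : H -> H) : Prop :=
  subnormal (iter n T).

(* Main.v *)
Require Import Defs.
From HB Require Import structures.
From mathcomp Require Import all_boot all_order all_algebra complex.
From mathcomp Require Import all_classical all_reals.

Set Implicit Arguments.
Unset Strict Implicit.
Unset Printing Implicit Defensive.

Import Order.TTheory GRing.Theory Num.Theory.
Local Open Scope ring_scope.

(** If [S] is an n-normal extension of [T], then [S^n] is a normal extension of
    [T^n], with the same embedding of Hilbert spaces.  It extends [T^n] because
    restriction to an invariant subspace is compatible with powers
    ([restricts_to_iter]).  To see that it is normal ([n_normal_iter]), let [A]
    be the adjoint of [S].  The adjoint of [S^n] is [A^n] ([adjoint_iter]), and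
    n-normality says that [A] commutes with [S^n]; hence so does every power of
    [A] ([iter_commute]), in particular [A^n]. *)

Lemma iter_commute (A : Type) (f g : A -> A) (m : nat) :
  f \o g = g \o f -> iter m f \o g = g \o iter m f.
Proof.
move=> fg; apply/funext => x /=.
by elim: m => //= m ->; exact: (congr1 (fun h => h (iter m f x)) fg).
Qed.

Lemma iter_linear (K : pzRingType) (V : lmodType K) (f : {linear V -> V})
    (m : nat) :
  linear (iter m f).
Proof. by move=> a x y; elim: m => //= m ->; rewrite linearP. Qed.

(** [normal_operator] takes its argument as a bundled linear map, so the power
    has to carry its linear structure explicitly. *)
Definition linear_iter (K : pzRingType) (V : lmodType K) (f : {linear V -> V})
    (m : nat) : {linear V -> V} :=
  HB.pack (iter m f) (GRing.isLinear.Build K V V *:%R (iter m f)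
                        (iter_linear f m)).

Section Powers.
Variables (R : realType) (H : hilbertType R).

Lemma bounded_operator_iter (S : {linear H -> H}) (m : nat) :
  bounded_operator S -> bounded_operator (linear_iter S m).
Proof.
move=> [M bS].
(* On the zero space the bound M can be any complex number, even a negative or
   non-real one; its modulus is a bound that can be multiplied. *)
have bS' x : `|S x| <= `|M| * `|x|.
  apply: le_trans (bS x) _.
  have /ger0_norm <- : 0 <= M * `|x| by apply: le_trans (bS x).
  by rewrite normrM normr_id.
exists (`|M| ^+ m) => x /=.
elim: m => [|m IHm] /=; first by rewrite expr0 mul1r.
by apply: le_trans (bS' _) _; rewrite exprS -mulrA ler_wpM2l.
Qed.

(** Moving the [m] factors [S] across the inner product one at a time shows
    that the m-th power of the adjoint of [S] has the property characterizing
    the adjoint of [S^m]. *)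
Lemma adjoint_iter (S : {linear H -> H}) (m : nat) :
  bounded_operator S -> adjoint (iter m S) = iter m (adjoint S).
Proof.
move=> bS; apply: adjoint_unique => x y.
by elim: m y => //= m IHm y; rewrite adjointP// IHm -iterSr.
Qed.

Lemma n_normal_iter (S : {linear H -> H}) (n : nat) :
  bounded_operator S -> n_normal n S -> normal_operator (linear_iter S n).
Proof.
by move=> bS nS; rewrite /normal_operator /= adjoint_iter//; exact: iter_commute.
Qed.

End Powers.

Lemma restricts_to_iter (R : realType) (H K : hilbertType R)
    (J : {linear H -> K}) (S : K -> K) (T : H -> H) (m : nat) :
  restricts_to J S T -> restricts_to J (iter m S) (iter m T).
Proof. by move=> ST x; elim: m => //= m ->. Qed.

Theorem corollary3p18 (R : realType) (H : hilbertType R) (n : nat)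
    (T : {linear H -> H}) :
  (0 < n)%N -> bounded_operator T -> sub_n_normal n T -> n_subnormal n T.
Proof.
move=> _ _ [K [J [S [embJ bS nS ST]]]].
exists K, J, (linear_iter S n); split=> //.
- exact: bounded_operator_iter.
- exact: n_normal_iter.
- exact: restricts_to_iter.
Qed.
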